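(* Let $(G,C,C^\vee)$ be a framework for $B$, let $\mathcal{A}_0(B)$ be the cluster algebra with principal coefficients and initial exchange matrix $B$, and let $\tilde v$ be a vertex of the universal cover $\hat G$, with $\operatorname{Seed}(\tilde v)$ as defined below. Then: (1) if $H^{\tilde v}=[h_{ie}]_{i\in I,e\in I(\tilde v)}$ is the bottom half of the extended exchange matrix of $\operatorname{Seed}(\tilde v)$, then $h_{ie}$ is the coefficient of $\alpha_i$ in the expansion of $C(\tilde v,e)$ in simple roots; (2) the rows of $H^{\tilde v}$ are sign-coherent (in each row the entries are all $\ge0$ or all $\le0$); (3) for each $e\in I(\tilde v)$, the ${\mathbf g}$-vector of the cluster variable $x^{\tilde v}_e$ of $\operatorname{Seed}(\tilde v)$ equals $R(\tilde v,e)$; (4) the ${\mathbf g}$-vectors ${\mathbf g}(x^{\tilde v}_e)$, $e\in I(\tilde v)$, form a $\mathbb Z$-basis of the weight lattice; (5) the $F$-polynomial of each $x^{\tilde v}_e$ has constant term $1$.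
   Context: Setting: $I$ finite, $|I|=n$; $B=[b_{ij}]_{i,j\in I}$ skew-symmetrizable integer matrix ($\delta(i)b_{ij}=-\delta(j)b_{ji}$, $\delta>0$); $V$ real vector space with basis of simple roots $\{\alpha_i\}$, simple co-roots $\alpha_i^\vee=\delta(i)^{-1}\alpha_i$; $V^*$ dual with pairing $\langle\cdot,\cdot\rangle$; fundamental weights $\rho_i$ = basis of $V^*$ dual to $\{\alpha_i^\vee\}$; weight lattice = $\mathbb Z$-span of the $\rho_i$; $\omega(\alpha_i^\vee,\alpha_j)=b_{ij}$; $[x]_+=\max(x,0)$. Framework: quasi-graphs are simple hypergraphs with half-edges (size 1) and full edges (size 2); degree counts all incident edges; connected = connected after discarding half-edges; $I(v)$ = edges containing $v$. A framework for $B$ is $(G,C,C^\vee)$, $G$ connected and regular of degree $n$, with $C(v,e),C^\vee(v,e)\in V$ for $e\in I(v)$ ($\beta^\vee:=C^\vee(v,e)$ when $\beta=C(v,e)$) satisfying: $C^\vee(v,e)$ is a positive multiple of $C(v,e)$; $C(v,e)\ne0$ and $\pm C(v,e)$ is in the nonnegative span of the simple roots ($\operatorname{sgn}(C(v,e))=\operatorname{sgn}(C^\vee(v,e))\in\{\pm1\}$ accordingly); some vertex $v_b$ has $C(v_b)=\{\alpha_i\}$, $C^\vee(v_b)=\{\alpha_i^\vee\}$ (identify $e\in I(v_b)$ with $i$ where $C(v_b,e)=\alpha_i$); if distinct $v,v'$ lie on edge $e$ then $C(v',e)=-C(v,e)$, $C^\vee(v',e)=-C^\vee(v,e)$, and for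 $\beta=C(v,e)$, $\gamma\in C(v)\setminus\{\beta\}$: $\gamma+[\operatorname{sgn}(\beta)\omega(\beta^\vee,\gamma)]_+\beta\in C(v')$ and $\gamma^\vee+[-\operatorname{sgn}(\beta^\vee)\omega(\gamma^\vee,\beta)]_+\beta^\vee\in C^\vee(v')$. For a full edge $e$ joining $v,v'$, $\mu_e:I(v)\to I(v')$: $\mu_e(e)=e$, and for $f\neq e$, $\mu_e(f)$ is the $f'\in I(v')$ with $C(v',f')=C(v,f)+[\operatorname{sgn}(C(v,e))\omega(C^\vee(v,e),C(v,f))]_+C(v,e)$. Each $C^\vee(v)$ is a basis of $V$ and $R(v)=\{R(v,e)\}$ is its dual basis in $V^*$: $\langle R(v,e),C^\vee(v,f)\rangle=\delta_{ef}$. Universal cover $\hat G$: vertices are sequences $(u_0,\dots,u_k)$ with $u_0=v_b$, $u_{i-1},u_i$ joined by edge $e_i$ of $G$, $e_i\neq e_{i+1}$; $(u_0,\dots,u_k)$ joined to $(u_0,\dots,u_{k-1})$ by a full edge over $e_k$; half-edges and all labels, co-labels, and $\mu$-maps are pulled back from $u_k$. Principal coefficients: $\mathcal{A}_0(B)$ has initial cluster $(x_i)_{i\in I}$, frozen variables $(y_i)_{i\in I}$ and extended exchange matrix $\tilde B=\binom{B}{\mathrm{Id}}$ whose bottom rows are indexed by a second copy of $I$ (row $i$ of the bottom half corresponds to $y_i$). Mutation at a column index $k$: $\tilde b'_{pq}=-\tilde b_{pq}$ if $p=k$ or $q=k$, else $\tilde b'_{pq}=\tilde b_{pq}+\operatorname{sgn}(\tilde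 b_{pk})[\tilde b_{pk}\tilde b_{kq}]_+$; the cluster variable $x_k$ is replaced by $x_k^{-1}\big(\prod_p z_p^{[\tilde b_{pk}]_+}+\prod_p z_p^{[-\tilde b_{pk}]_+}\big)$, $p$ over all rows, $z_p$ the cluster or frozen variable of row $p$; other cluster variables are unchanged. $\operatorname{Seed}(u_0,\dots,u_k)$ is obtained from the initial seed (indexed by $I=I(v_b)$) by mutating successively at $e_1,\dots,e_k$, where after the $j$-th mutation the column indices (and cluster variable indices) are transported from $I(u_{j-1})$ to $I(u_j)$ via $\mu_{e_j}$; the cluster variable of $\operatorname{Seed}(\tilde v)$ indexed by $e$ is $x^{\tilde v}_e$. The ${\mathbf g}$-vector: $\mathcal{A}_0(B)$ is graded by the weight lattice with $\deg x_i=\rho_i$ and $\deg y_j=-\sum_{i}b_{ij}\rho_i$; every cluster variable $x$ is homogeneous and ${\mathbf g}(x)$ is its degree. The $F$-polynomial of a cluster variable is the (polynomial) obtained from its expression as a rational function in $x_i,y_i$ by setting all $x_i=1$.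
   Formalization: In (2), sign-coherence is stated for the columns of H (for each e, the entries h_ie over i are all ≥0 or all ≤0) instead of the rows, since the row claim fails: in type A_2 with b_12=1, one mutation at 1 gives H=[[-1,1],[0,1]], whose first row is (-1,1). *)

(* Defs.v *)
Set Warnings "-notation-overridden,-notation-incompatible-prefix".
From HB Require Import structures.
From mathcomp Require Import all_boot all_order all_algebra finmap.
From mathcomp Require Import fraction.
From mathcomp.multinomials Require Import mpoly.
From Stdlib Require ClassicalEpsilon.

Set Implicit Arguments.
Unset Strict Implicit.
Unset Printing Implicit Defensive.

Import Order.TTheory GRing.Theory Num.Theory.
Local Open Scope fset_scope.
Local Open Scope ring_scope.

Definition pospart (A : realDomainType) (x : A) : A := Num.max x 0.

Definition skew_symmetrizable (R : realFieldType) (I : finType)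
    (b : I -> I -> int) (delta : I -> R) : Prop :=
  (forall i, 0 < delta i) /\
  (forall i j, delta i * (b i j)%:~R = - (delta j * (b j i)%:~R)).

Section RootSpace.
Variables (R : realFieldType) (I : finType) (b : I -> I -> int) (delta : I -> R).

Definition rootspace : vectType R := {ffun I -> R^o}.
Definition weightspace : vectType R := 'Hom(rootspace, R^o).

Definition coef (x : rootspace) (i : I) : R := (x : {ffun I -> R^o}) i.
Definition simple_root (i : I) : rootspace := [ffun j => (j == i)%:R : R^o].
Definition simple_coroot (i : I) : rootspace := (delta i)^-1 *: simple_root i.

(* The bilinear form with omega (simple_coroot i) (simple_root j) = b i j; since
   simple_root i = delta i *: simple_coroot i, its Gram matrix on simple roots is
   delta i * b i j. *)
Definition omega (x y : rootspace) : R :=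
  \sum_i \sum_j coef x i * coef y j * (delta i * (b i j)%:~R).

Lemma omega_simple (i j : I) :
  delta i != 0 -> omega (simple_coroot i) (simple_root j) = (b i j)%:~R.
Proof.
move=> di; rewrite /omega (bigD1 i) //= (bigD1 j) //= /coef !ffunE !eqxx.
rewrite [X in _ + X + _]big1 => [|k /negbTE kj]; last first.
  by rewrite !ffunE kj mulr0 mul0r.
rewrite [X in _ + X]big1 => [|k /negbTE ki]; last first.
  by rewrite big1 // => l _; rewrite !ffunE ki scaler0 !mul0r.
by rewrite !addr0 mulr1 -[_ *: _]/(_ * _) mulr1 mulrA mulVf // mul1r.
Qed.

Definition nonneg (x : rootspace) : Prop := forall i, 0 <= coef x i.

(* Meaningful for nonzero x with nonneg x or nonneg (- x). *)
Definition rsgn (x : rootspace) : R :=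
  if [forall i, 0 <= coef x i] then 1 else -1.

(* When the family X is a basis of the root space, this is the dual basis. *)
Definition dual_basis (J : finType) (X : J -> rootspace) (j : J) : weightspace :=
  linfun (coord (codom_tuple X) (enum_rank j) : rootspace -> R^o).

Lemma dual_basisE (J : finType) (X : J -> rootspace) (j k : J) :
  free (codom X) -> dual_basis X j (X k) = (j == k)%:R.
Proof.
move=> fX; rewrite lfunE /=.
have -> : X k = (codom_tuple X)`_(enum_rank k).
  by rewrite (nth_map k) -?cardE ?ltn_ord // nth_enum_rank.
by rewrite coord_free // (inj_eq enum_rank_inj) eq_sym.
Qed.

Definition rho (i : I) : weightspace := dual_basis simple_coroot i.

Definition weight_lattice (w : weightspace) : Prop :=
  exists c : I -> int, w = \sum_i rho i *~ c i.

Definition Zbasis_of_weight_lattice (J : finType) (g : J -> weightspace) : Prop :=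
  (forall j, weight_lattice (g j)) /\
  (forall w, weight_lattice w ->
     exists! c : {ffun J -> int}, w = \sum_j g j *~ c j).

End RootSpace.

(* [star v] is the finite set of (half- or full) edges containing [v].  No
   condition is imposed on two half-edges at the same vertex. *)
Record quasigraph := QuasiGraph {
  vertex : choiceType;
  edge : choiceType;
  star : vertex -> {fset edge};
  edge_nonempty : forall e, exists v, e \in star v;
  edge_size_le2 : forall e u v w, e \in star u -> e \in star v -> e \in star w ->
    [|| u == v, v == w | u == w];
  edge_simple : forall e f u v, u != v ->
    e \in star u -> e \in star v -> f \in star u -> f \in star v -> e = f
}.

Definition qadj (G : quasigraph) : rel (vertex G) :=
  fun u v => (u != v) && (star u `&` star v != fset0).

Definition qconnected (G : quasigraph) : Prop :=
  forall u v : vertex G, exists p, path (@qadj G) u p /\ last u p = v.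

Definition qregular (G : quasigraph) (n : nat) : Prop :=
  forall v : vertex G, #|` star v| = n.

Record framework (R : realFieldType) (I : finType) (b : I -> I -> int)
    (delta : I -> R) (G : quasigraph) := Framework {
  lab : forall v : vertex G, star v -> rootspace R I;
  colab : forall v : vertex G, star v -> rootspace R I;
  base : vertex G;
  fw_connected : qconnected G;
  fw_regular : qregular G #|I|;
  colab_pos : forall (v : vertex G) (e : star v),
    exists2 c : R, 0 < c & colab e = c *: lab e;
  lab_neq0 : forall (v : vertex G) (e : star v), lab e != 0;
  lab_sign : forall (v : vertex G) (e : star v),
    nonneg (lab e) \/ nonneg (- lab e);
  base_lab : forall e : star base, exists i, lab e == simple_root R i;
  base_lab_onto : forall i, exists e : star base, lab e = simple_root R i;
  base_colab : forall e : star base, exists i, colab e = simple_coroot delta i;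
  base_colab_onto : forall i, exists e : star base, colab e = simple_coroot delta i;
  lab_opp : forall (v v' : vertex G) (e : star v) (e' : star v'),
    v != v' -> val e = val e' ->
    lab e' = - lab e /\ colab e' = - colab e;
  lab_trans : forall (v v' : vertex G) (e : star v) (e' : star v'),
    v != v' -> val e = val e' ->
    forall f : star v, lab f != lab e ->
    exists f' : star v', lab f' =
      lab f + pospart (rsgn (lab e) * omega b delta (colab e) (lab f)) *: lab e;
  colab_trans : forall (v v' : vertex G) (e : star v) (e' : star v'),
    v != v' -> val e = val e' ->
    forall f : star v, lab f != lab e ->
    exists f' : star v', colab f' =
      colab f + pospart (- rsgn (colab e) * omega b delta (colab f) (lab e))
                *: colab e
}.

Section Framework.
Variables (R : realFieldType) (I : finType) (b : I -> I -> int) (delta : I -> R).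
Variables (G : quasigraph) (F : framework b delta G).

(* [e] and [e'] are the same full edge, seen in [star v] and in [star v']. *)
Definition mu_edge (v v' : vertex G) (e : star v) (e' : star v') (f : star v) :
    star v' :=
  if f == e then e' else
  odflt e' [pick f' : star v' | lab F f' ==
    lab F f +
    pospart (rsgn (lab F e) * omega b delta (colab F e) (lab F f)) *: lab F e].

Definition mu_edge_inv (v v' : vertex G) (e : star v) (e' : star v')
    (f' : star v') : star v :=
  odflt e [pick f : star v | mu_edge e e' f == f'].

(* Walks from the base vertex in the quasi-graph.  The edge used in a step is
   recorded, although by simplicity it is determined by the two vertices. *)
Inductive walk : vertex G -> Type :=
| walk_base : walk (base F)
| walk_step (u : vertex G) (w : walk u) (v : vertex G) (e : edge G)
    (uv : u != v) (eu : e \in star u) (ev : e \in star v) : walk v.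

Definition last_edge (u : vertex G) (w : walk u) : option (edge G) :=
  if w is walk_step _ _ _ e _ _ _ then Some e else None.

Fixpoint reduced (u : vertex G) (w : walk u) : bool :=
  if w is walk_step _ w' _ e _ _ _ then reduced w' && (last_edge w' != Some e)
  else true.

(* Vertices of the universal cover.  The edges at such a vertex, with their
   labels and co-labels, are pulled back from its image [cover_end] in G, so
   they are indexed by [star cover_end]. *)
Record cover_vertex := CoverVertex {
  cover_end : vertex G;
  cover_walk : walk cover_end;
  cover_reduced : reduced cover_walk
}.

Definition cover_star (v : cover_vertex) : {fset edge G} := star (cover_end v).
Definition cover_lab (v : cover_vertex) (e : cover_star v) : rootspace R I :=
  lab F e.
Definition cover_colab (v : cover_vertex) (e : cover_star v) : rootspace R I :=
  colab F e.
Definition cover_R (v : cover_vertex) (e : cover_star v) : weightspace R I :=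
  dual_basis (@cover_colab v) e.

Definition base_index (e : star (base F)) : I := xchoose (base_lab e).

End Framework.

Section ClusterAlgebra.
Variables (I : finType) (b : I -> I -> int).

(* The first block of variables is x, the second block is y. *)
Definition xypoly : idomainType := {mpoly rat[#|I| + #|I|]}.
Definition ypoly : idomainType := {mpoly rat[#|I|]}.
Definition xyfield : fieldType := {fraction xypoly}.
Definition yfield : fieldType := {fraction ypoly}.

Definition xvar (i : I) : xyfield :=
  tofrac ('X_(lshift #|I| (enum_rank i)) : xypoly).
Definition yvar (i : I) : xyfield :=
  tofrac ('X_(rshift #|I| (enum_rank i)) : xypoly).

(* Columns and cluster variables are indexed by J, rows by J (top half) and by
   I (bottom half). *)
Record seed (J : finType) := Seed {
  exmat : J + I -> J -> int;
  cvar : J -> xyfield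
}.

Definition row_var (J : finType) (s : seed J) (p : J + I) : xyfield :=
  match p with inl j => cvar s j | inr i => yvar i end.

Definition mutation (J : finType) (k : J) (s : seed J) : seed J :=
  let B := exmat s in
  Seed
    (fun p q => if (p == inl k) || (q == k) then - B p q
                else B p q + Num.sg (B p k) * pospart (B p k * B (inl k) q))
    (fun q => if q == k then
                (cvar s k)^-1 * (\prod_p row_var s p ^ pospart (B p k)
                                 + \prod_p row_var s p ^ pospart (- B p k))
              else cvar s q).

Definition reindex_seed (J J' : finType) (g : J' -> J) (s : seed J) : seed J' :=
  Seed
    (fun p q => exmat s (match p with inl j => inl (g j) | inr i => inr i end)
                        (g q))
    (fun q => cvar s (g q)).

Definition initial_seed : seed I :=
  Seed (fun p q => match p with inl j => b j q | inr i => (i == q)%:Z end) xvar.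

Section Gvector.
Variables (R : realFieldType) (delta : I -> R).

Definition var_degree (k : 'I_(#|I| + #|I|)) : weightspace R I :=
  match split k with
  | inl a => rho delta (enum_val a)
  | inr a => - \sum_i rho delta i *~ b i (enum_val a)
  end.

Definition mono_degree (m : 'X_{1.. #|I| + #|I|}) : weightspace R I :=
  \sum_k var_degree k *+ m k.

Definition homog_poly (p : xypoly) (d : weightspace R I) : Prop :=
  forall m, m \in msupp p -> mono_degree m = d.

Definition homogeneous (z : xyfield) (d : weightspace R I) : Prop :=
  exists (p q : xypoly) (dp dq : weightspace R I),
    [/\ p != 0, q != 0, z = tofrac p / tofrac q,
        homog_poly p dp /\ homog_poly q dq & d = dp - dq].

Definition gvector (z : xyfield) : weightspace R I :=
  ClassicalEpsilon.epsilon (inhabits 0) (homogeneous z).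

Lemma mono_degreeD m1 m2 :
  mono_degree (m1 + m2)%MM = mono_degree m1 + mono_degree m2.
Proof.
rewrite /mono_degree -big_split /=; apply: eq_bigr => k _.
by rewrite mnmDE mulrnDr.
Qed.

Lemma homog_polyM p q dp dq :
  homog_poly p dp -> homog_poly q dq -> homog_poly (p * q) (dp + dq).
Proof.
move=> hp hq m /msuppM_le /allpairsP[[m1 m2] /= [/hp <- /hq <- ->]].
exact: mono_degreeD.
Qed.

Lemma homog_poly_uniq p d d' :
  p != 0 -> homog_poly p d -> homog_poly p d' -> d = d'.
Proof. by move=> /mlead_supp sp hd hd'; rewrite -(hd _ sp) (hd' _ sp). Qed.

Lemma homogeneous_uniq z d d' : homogeneous z d -> homogeneous z d' -> d = d'.
Proof.
move=> [p [q [dp [dq [p0 q0 -> [hp hq] ->]]]]].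
move=> [p' [q' [dp' [dq' [p0' q0' e [hp' hq'] ->]]]]].
move/eqP: e; rewrite eqr_div ?tofrac_eq0 // -!tofracM tofrac_eq => /eqP e.
have h := homog_polyM hp hq'; rewrite e in h.
have := homog_poly_uniq (mulf_neq0 p0' q0) h (homog_polyM hp' hq).
by move=> E; apply/eqP; rewrite subr_eq addrAC -E addrK.
Qed.

(* On homogeneous elements, [gvector] is the degree. *)
Lemma gvectorE z d : homogeneous z d -> gvector z = d.
Proof.
move=> hz; apply: (@homogeneous_uniq z) => //.
by apply: ClassicalEpsilon.epsilon_spec; exists d.
Qed.

End Gvector.

Definition subst_x1 (p : xypoly) : ypoly :=
  comp_mpoly [tuple match split k with
                    | inl _ => 1
                    | inr a => 'X_a
                    end | k < #|I| + #|I|] p.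

(* f is obtained from z by setting all the x variables to 1.  For a cluster
   variable z, f is a polynomial by the Laurent phenomenon; as a specialization
   it is a priori only a rational function in y. *)
Definition Fpolynomial (z : xyfield) (f : yfield) : Prop :=
  exists p q : xypoly,
    [/\ subst_x1 q != 0, z = tofrac p / tofrac q
      & f = tofrac (subst_x1 p) / tofrac (subst_x1 q)].

(* The constant term at the origin of a rational function regular there; on
   polynomials this is the usual constant term, see [constant_term_poly]. *)
Definition constant_term (f : yfield) (c : rat) : Prop :=
  exists p q : ypoly,
    [/\ q@_0 != 0, f = tofrac p / tofrac q & c = p@_0 / q@_0].

Lemma constant_term_poly (p : ypoly) (c : rat) :
  constant_term (tofrac p) c <-> p@_0 = c.
Proof.
split=> [[a [q [q0 /eqP e ->]]]|<-]; last first.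
  by exists p, 1; rewrite tofrac1 !divr1 mcoeff1 eqxx divr1 oner_neq0.
have q_neq0 : q != 0 by apply: contraNneq q0 => ->; rewrite mcoeff0.
move: e; rewrite -[X in X == _]divr1 -tofrac1.
rewrite eqr_div ?tofrac_eq0 ?oner_neq0 // -!tofracM tofrac_eq => /eqP.
rewrite mulr1 => <-.
by rewrite (rmorphM (mcoeff 0%MM)) mulfK.
Qed.

End ClusterAlgebra.

Fixpoint walk_seed (R : realFieldType) (I : finType) (b : I -> I -> int)
    (delta : I -> R) (G : quasigraph) (F : framework b delta G)
    (u : vertex G) (w : walk F u) : seed I (star u) :=
  match w in walk _ u return seed I (star u) with
  | walk_base => reindex_seed (@base_index _ _ _ _ _ F) (initial_seed b)
  | walk_step _ w' _ e _ eu ev =>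
      reindex_seed (mu_edge_inv F [` eu] [` ev])
                   (mutation [` eu] (walk_seed w'))
  end.

Definition cover_seed (R : realFieldType) (I : finType) (b : I -> I -> int)
    (delta : I -> R) (G : quasigraph) (F : framework b delta G)
    (v : cover_vertex F) : seed I (cover_star v) :=
  walk_seed (cover_walk v).

(* Main.v *)
(** A seed reached by mutations from the initial one is determined by the labels:
    its bottom half lists the coordinates of the labels, and its top half is the
    matrix of [omega] between co-labels and labels.  Both are preserved because
    the sign of a label is the sign of a whole column of the bottom half, so that
    matrix mutation becomes the transition rule of the framework.  The top and
    bottom contributions to the difference of the degrees of the two exchange
    monomials are [omega _ beta] and [- omega _ beta], with [beta] the label of the
    mutated edge.  Hence exchange relations are homogeneous, and taking the degree
    on the monomial without [y]'s gives the rule for mutating the dual basis of the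
    co-labels.  Exactly one of the two monomials involves some [y], so at [x = 1],
    [y = 0] every cluster variable takes the value [1].  Finally, a weight is
    integral on the simple co-roots iff it is integral on the co-labels at any
    vertex, which gives the lattice statement. *)
Require Import Defs.
From HB Require Import structures.
From mathcomp Require Import all_boot all_order all_algebra finmap.
From mathcomp Require Import fraction ring lra.
From mathcomp.multinomials Require Import mpoly.

Set Implicit Arguments.
Unset Strict Implicit.
Unset Printing Implicit Defensive.

Import Order.TTheory GRing.Theory Num.Theory.
Local Open Scope ring_scope.

(** * The positive part and its interplay with signs *)

Section PositivePart.
Variable A : realDomainType.
Implicit Types s x y : A.

Lemma pospart_ge0 x : 0 <= pospart x.
Proof. by rewrite /pospart le_max lexx orbT. Qed.

Lemma pospartB x : pospart x - pospart (- x) = x.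
Proof.
rewrite /pospart /Num.max oppr_lt0.
by case: (ltgtP x 0) => [||->]; rewrite ?sub0r ?opprK ?subr0 ?oppr0.
Qed.

Lemma pospartMl x y : 0 <= x -> pospart (x * y) = x * pospart y.
Proof. by move=> x0; rewrite /pospart maxr_pMr // mulr0. Qed.

Lemma pospart_id x : 0 <= x -> pospart x = x.
Proof. by move=> x0; rewrite /pospart max_l. Qed.

Lemma pospart_eq0 x : x <= 0 -> pospart x = 0.
Proof. by move=> x0; rewrite /pospart max_r. Qed.

(** A nonzero [x] must have sign [s], and [|x|] comes out of the positive part. This replaces the
    entrywise signs in matrix mutation by one sign for a whole column. *)
Lemma sg_pospartM s x y :
  s = 1 \/ s = -1 -> 0 <= s * x -> Num.sg x * pospart (x * y) = pospart (s * y) * x.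
Proof.
move=> hs sx; case: (ltgtP x 0) => [x0|x0|->]; last by rewrite sgr0 mul0r mulr0.
  have -> : s = -1 by case: hs sx => // ->; rewrite mul1r leNgt x0.
  rewrite ltr0_sg // !mulN1r -[x * y]mulrNN pospartMl ?oppr_ge0 1?ltW //.
  by rewrite mulNr opprK mulrC.
have -> : s = 1 by case: hs sx => // ->; rewrite mulN1r oppr_ge0 leNgt x0.
by rewrite gtr0_sg // !mul1r pospartMl 1?ltW // mulrC.
Qed.

(** The right-hand side is the same for [s] and [- s], by [pospartB], so the sign can be chosen to
    agree with that of [x]. *)
Lemma sg_pospart_exchange s x y : s = 1 \/ s = -1 ->
  Num.sg x * pospart (x * y) = pospart (- s * x) * y + x * pospart (s * y).
Proof.
move=> hs; have [sx|/ltW sx] := leP 0 (s * x).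
  rewrite (sg_pospartM _ hs) // (@pospart_eq0 (- s * x)) ?mulNr ?oppr_le0 //.
  by rewrite mul0r add0r mulrC.
have hs' : - s = 1 \/ - s = -1 by case: hs => ->; rewrite ?opprK; [right|left].
have sx' : 0 <= - s * x by rewrite mulNr oppr_ge0.
rewrite (sg_pospartM _ hs') // (pospart_id sx') mulNr.
have := pospartB (s * y); set u := pospart _; set v := pospart _ => uv.
have -> : v = u - s * y by rewrite -uv; ring.
by case: hs => ->; ring.
Qed.

End PositivePart.

Lemma intr_pospart (A : realDomainType) (z : int) : ((pospart z)%:~R : A) = pospart z%:~R.
Proof.
have [z0|/ltW z0] := leP 0 z; first by rewrite !pospart_id ?ler0z.
by rewrite !pospart_eq0 ?lerz0.
Qed.

(** * Bilinearity of [omega], dual families and the weight lattice *)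

Section Roots.
Variables (R : realFieldType) (I : finType) (b : I -> I -> int) (delta : I -> R).
Hypothesis hb : skew_symmetrizable b delta.
Implicit Types x y z : rootspace R I.
Local Notation V := (rootspace R I).
Local Notation om := (omega b delta).

Lemma coefD x y i : coef (x + y) i = coef x i + coef y i.
Proof. by rewrite /coef ffunE. Qed.
Lemma coefN x i : coef (- x) i = - coef x i.
Proof. by rewrite /coef ffunE. Qed.
Lemma coefZ a x i : coef (a *: x) i = a * coef x i.
Proof. by rewrite /coef ffunE. Qed.
Lemma coef_simple_root (i j : I) : coef (simple_root R i) j = (j == i)%:R.
Proof. by rewrite /coef ffunE. Qed.

Lemma omegaDl x y z : om (x + y) z = om x z + om y z.
Proof.
rewrite /omega -big_split; apply: eq_bigr => i _.
by rewrite -big_split; apply: eq_bigr => j _ /=; rewrite coefD !mulrDl.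
Qed.
Lemma omegaZl a x z : om (a *: x) z = a * om x z.
Proof.
rewrite /omega mulr_sumr; apply: eq_bigr => i _.
by rewrite mulr_sumr; apply: eq_bigr => j _; rewrite coefZ !mulrA.
Qed.
Lemma omegaC x y : om x y = - om y x.
Proof.
rewrite /omega exchange_big -sumrN; apply: eq_bigr => i _.
rewrite -sumrN; apply: eq_bigr => j _; rewrite hb.2; ring.
Qed.
Lemma omegaxx x : om x x = 0.
Proof. by have := omegaC x x; lra. Qed.
Lemma omegaDr x y z : om z (x + y) = om z x + om z y.
Proof. by rewrite omegaC omegaDl opprD -!omegaC. Qed.
Lemma omegaZr a x z : om z (a *: x) = a * om z x.
Proof. by rewrite omegaC omegaZl -mulrN -omegaC. Qed.
Lemma omegaNl x z : om (- x) z = - om x z.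
Proof. by rewrite -scaleN1r omegaZl mulN1r. Qed.
Lemma omegaNr x z : om z (- x) = - om z x.
Proof. by rewrite -scaleN1r omegaZr mulN1r. Qed.

Lemma root_expansion x : x = \sum_i coef x i *: simple_root R i.
Proof.
apply/ffunP => j; rewrite sum_ffunE (bigD1 j) //= big1 => [|i ij].
  by rewrite !ffunE eqxx addr0 -[_ *: _]/(_ * _) mulr1.
by rewrite !ffunE eq_sym (negbTE ij) scaler0.
Qed.

Lemma rsgnP x : nonneg x \/ nonneg (- x) ->
  (rsgn x = 1 \/ rsgn x = -1) /\ forall i, 0 <= rsgn x * coef x i.
Proof.
rewrite /rsgn; case: forallP => [x0 _|nx0 [|x0]].
- by split=> [|i]; [left|rewrite mul1r].
- by move=> /nx0.
by split=> [|i]; [right|rewrite mulN1r -coefN].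
Qed.

Lemma rsgnZ a x : 0 < a -> rsgn (a *: x) = rsgn x.
Proof.
move=> a0; rewrite /rsgn; congr (if _ then _ else _).
by apply: eq_forallb => i; rewrite coefZ pmulr_rge0.
Qed.

Definition dual_families (J : finType) (X : J -> V) (Y : J -> weightspace R I) :=
  forall e f, Y e (X f) = (e == f)%:R.

Lemma dual_families_free (J : finType) (X : J -> V) Y :
  dual_families X Y -> free (codom X).
Proof.
move=> XY; rewrite -[codom X]/(tval (codom_tuple X)); apply/freeP => k k0 i.
have nthX (j : 'I_#|J|) : (codom_tuple X)`_j = X (enum_val j).
  by rewrite (nth_map (enum_val j)) -?cardE // -enum_val_nth.
have /(congr1 (Y (enum_val i))) := k0.
rewrite linear0 linear_sum (bigD1 i) //= big1 => [|j ji].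
  by rewrite linearZ /= nthX XY eqxx addr0 -[_ *: _]/(_ * _) mulr1.
by rewrite linearZ /= nthX XY (inj_eq enum_val_inj) eq_sym (negbTE ji) scaler0.
Qed.

(* A family of [dim V] vectors that admits a dual family is a basis. *)
Lemma weight_eq (J : finType) (X : J -> V) Y (w w' : weightspace R I) :
  #|J| = #|I| -> dual_families X Y -> (forall j, w (X j) = w' (X j)) -> w = w'.
Proof.
move=> cJ XY ww'; apply/lfunP => x.
have xX : x \in <<codom_tuple X>>%VS.
  suff -> : <<codom_tuple X>>%VS = fullv by rewrite memvf.
  apply/eqP; rewrite eqEdim subvf /=.
  have := dual_families_free XY; rewrite /free => /eqP ->.
  by rewrite size_codom cJ dimvf /dim /= muln1.
rewrite (coord_span xX) !linear_sum; apply: eq_bigr => i _; rewrite !linearZ /=.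
by rewrite (nth_map (enum_val i)) -?cardE // ww'.
Qed.

Lemma dual_families_sum (J : finType) (X : J -> V) Y (a : J -> int) f :
  dual_families X Y -> (\sum_j Y j *~ a j) (X f) = (a f)%:~R.
Proof.
move=> XY; rewrite sum_lfunE (bigD1 f) //= big1 => [|j jf].
  by rewrite -scaler_int scale_lfunE XY eqxx addr0 -[_ *: _]/(_ * _) mulr1.
by rewrite -scaler_int scale_lfunE XY (negbTE jf) scaler0.
Qed.

Lemma coroot_dual : dual_families (simple_coroot delta) (rho delta).
Proof.
move=> i j; apply: dual_basisE.
(* It remains to see that the simple co-roots are free; the coordinates rescaled by [delta] are an
   explicit dual family. *)
pose Y k : weightspace R I := linfun (fun x : V => delta k * coef x k : R^o).
apply: (@dual_families_free _ _ Y) => e f; rewrite /Y.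
have lin : linear (fun x : V => delta e * coef x e : R^o).
  by move=> a x y; rewrite coefD coefZ mulrDr mulrCA.
pose L := GRing.isLinear.Build R V R^o _ _ lin.
pose Lf : {linear V -> R^o} := HB.pack (fun x : V => delta e * coef x e : R^o) L.
rewrite -[linfun _]/(linfun Lf) lfunE /= coefZ coef_simple_root.
have [->|] := eqVneq; last by rewrite !mulr0.
by rewrite mulr1 mulfV // gt_eqF // hb.1.
Qed.

Definition isint (x : R) := exists z : int, x = z%:~R.

Lemma isint_int (z : int) : isint z%:~R. Proof. by exists z. Qed.
Lemma isintD (x y : R) : isint x -> isint y -> isint (x + y).
Proof. by move=> [z ->] [t ->]; exists (z + t); rewrite intrD. Qed.
Lemma isintN (x : R) : isint x -> isint (- x).
Proof. by move=> [z ->]; exists (- z); rewrite mulrNz. Qed.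
Lemma isintM (x y : R) : isint x -> isint y -> isint (x * y).
Proof. by move=> [z ->] [t ->]; exists (z * t); rewrite intrM. Qed.

(** The coefficients on the fundamental weights are the values on the simple co-roots. Membership
    becomes a condition that can be carried along mutations. *)
Lemma weight_latticeP (w : weightspace R I) :
  weight_lattice delta w <-> forall i, isint (w (simple_coroot delta i)).
Proof.
split=> [[c ->] i|wi]; first by exists (c i); apply: dual_families_sum coroot_dual.
have /fin_all_exists[c wc] := wi.
exists c; apply: (weight_eq erefl coroot_dual) => j.
by rewrite (dual_families_sum _ _ coroot_dual).
Qed.

End Roots.

(** * Evaluation of rational functions at [x = 1], [y = 0] *)

Section ClusterVariables.
Variables (I : finType) (b : I -> I -> int).

(* Locked, because comparing two values up to conversion does not terminate in
   practice. *)
Definition eval_x1y0 : xypoly I -> rat := locked (fun p => (subst_x1 p)@_0).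

Lemma eval_x1y0E p : eval_x1y0 p = (subst_x1 p)@_0.
Proof. by rewrite /eval_x1y0 -lock. Qed.
Lemma eval_x1y0D p q : eval_x1y0 (p + q) = eval_x1y0 p + eval_x1y0 q.
Proof. by rewrite !eval_x1y0E /subst_x1 raddfD /= mcoeffD. Qed.
Lemma eval_x1y0M p q : eval_x1y0 (p * q) = eval_x1y0 p * eval_x1y0 q.
Proof. by rewrite !eval_x1y0E /subst_x1 rmorphM /= (rmorphM (mcoeff 0%MM)). Qed.
Lemma eval_x1y00 : eval_x1y0 0 = 0.
Proof. by rewrite eval_x1y0E /subst_x1 raddf0 mcoeff0. Qed.
Lemma eval_x1y01 : eval_x1y0 1 = 1.
Proof. by rewrite eval_x1y0E /subst_x1 rmorph1 mcoeff1 eqxx. Qed.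

(** A relation, since a value exists only if some fraction representing [z] has a denominator that
    does not vanish at the point. *)
Definition evaluates_to (z : xyfield I) (c : rat) :=
  exists p q : xypoly I,
    [/\ eval_x1y0 q != 0, z = tofrac p / tofrac q & c = eval_x1y0 p / eval_x1y0 q].

Lemma eval_neq0 p : eval_x1y0 p != 0 -> (tofrac p : xyfield I) != 0.
Proof.
by rewrite tofrac_eq0; apply: contraNneq => ->; rewrite eval_x1y00.
Qed.

Lemma evaluates_to_neq0 z c : evaluates_to z c -> c != 0 -> z != 0.
Proof.
move=> [p [q [q0 -> ->]]]; rewrite mulf_eq0 negb_or => /andP[/eval_neq0 p0 _].
exact: mulf_neq0 p0 (invr_neq0 (eval_neq0 q0)).
Qed.

Lemma evaluates_to_poly p : evaluates_to (tofrac p) (eval_x1y0 p).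
Proof. by exists p, 1; rewrite eval_x1y01 tofrac1 !divr1. Qed.

Lemma evaluates_toD z c z' c' :
  evaluates_to z c -> evaluates_to z' c' -> evaluates_to (z + z') (c + c').
Proof.
move=> [p [q [q0 -> ->]]] [p' [q' [q0' -> ->]]].
exists (p * q' + p' * q), (q * q'); split.
- by rewrite eval_x1y0M mulf_neq0.
- by rewrite (addf_div _ _ (eval_neq0 q0) (eval_neq0 q0')) -!tofracM -tofracD.
by rewrite addf_div // eval_x1y0D !eval_x1y0M.
Qed.

Lemma evaluates_toM z c z' c' :
  evaluates_to z c -> evaluates_to z' c' -> evaluates_to (z * z') (c * c').
Proof.
move=> [p [q [q0 -> ->]]] [p' [q' [q0' -> ->]]].
exists (p * p'), (q * q'); split; first by rewrite eval_x1y0M mulf_neq0.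
  by rewrite mulf_div -!tofracM.
by rewrite mulf_div !eval_x1y0M.
Qed.

Lemma evaluates_toV z c : evaluates_to z c -> c != 0 -> evaluates_to z^-1 c^-1.
Proof.
move=> [p [q [q0 -> ->]]]; rewrite mulf_eq0 negb_or => /andP[p0 _].
by exists q, p; rewrite !invf_div.
Qed.

Lemma evaluates_to1 : evaluates_to 1 1.
Proof. by rewrite -eval_x1y01 -tofrac1; apply: evaluates_to_poly. Qed.

Lemma evaluates_to_pospart z c (a : int) :
  evaluates_to z c -> evaluates_to (z ^ pospart a) (c ^ pospart a).
Proof.
move=> zc; case: (pospart a) (pospart_ge0 a) => // n _; rewrite -!exprnP.
by elim: n => [|n IHn]; [apply: evaluates_to1|rewrite !exprS; apply: evaluates_toM].
Qed.

Lemma evaluates_to_prod (J : finType) (z : J -> xyfield I) (c : J -> rat) :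
  (forall j, evaluates_to (z j) (c j)) -> evaluates_to (\prod_j z j) (\prod_j c j).
Proof.
move=> zc; elim/big_ind2: _ => //; first exact: evaluates_to1.
by move=> *; apply: evaluates_toM.
Qed.

Lemma evaluates_to_xvar i : evaluates_to (xvar i) 1.
Proof.
suff -> : 1 = eval_x1y0 'X_(lshift #|I| (enum_rank i)) by apply: evaluates_to_poly.
rewrite eval_x1y0E /subst_x1 comp_mpolyXU -tnth_nth tnth_mktuple.
by rewrite -[lshift _ _]/(unsplit (inl _)) unsplitK mcoeff1 eqxx.
Qed.

Lemma evaluates_to_yvar i : evaluates_to (yvar i) 0.
Proof.
suff -> : 0 = eval_x1y0 'X_(rshift #|I| (enum_rank i)) by apply: evaluates_to_poly.
rewrite eval_x1y0E /subst_x1 comp_mpolyXU -tnth_nth tnth_mktuple.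
by rewrite -[rshift _ _]/(unsplit (inr _)) unsplitK mcoeffX mnm1_eq0.
Qed.

(** One fraction serves twice: setting [x = 1] gives the specialization, and then [y = 0] gives its
    constant term. *)
Lemma evaluates_to_Fpolynomial z c :
  evaluates_to z c -> exists2 f, Fpolynomial z f & constant_term f c.
Proof.
move=> [p [q [q0 zE cE]]].
exists (tofrac (subst_x1 p) / tofrac (subst_x1 q)).
  by exists p, q; split=> //; apply: contraNneq q0 => q0; rewrite eval_x1y0E q0 mcoeff0.
by exists (subst_x1 p), (subst_x1 q); rewrite -!eval_x1y0E.
Qed.

(** * Homogeneous rational functions *)

Variables (R : realFieldType) (delta : I -> R).
Local Notation hmg := (homogeneous b delta).

Lemma homogeneousM z d z' d' : hmg z d -> hmg z' d' -> hmg (z * z') (d + d').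
Proof.
move=> [p [q [dp [dq [p0 q0 -> [hp hq] ->]]]]].
move=> [p' [q' [dp' [dq' [p0' q0' -> [hp' hq'] ->]]]]].
exists (p * p'), (q * q'), (dp + dp'), (dq + dq'); split; rewrite ?mulf_neq0 //.
- by rewrite mulf_div -!tofracM.
- by split; apply: homog_polyM.
- by rewrite opprD addrACA.
Qed.

Lemma homogeneousV z d : hmg z d -> hmg z^-1 (- d).
Proof.
move=> [p [q [dp [dq [p0 q0 -> [hp hq] ->]]]]].
by exists q, p, dq, dp; split; rewrite ?invf_div ?opprB.
Qed.

Lemma homogeneousD z z' d : hmg z d -> hmg z' d -> z + z' != 0 -> hmg (z + z') d.
Proof.
move=> [p [q [dp [dq [p0 q0 -> [hp hq] dE]]]]].
move=> [p' [q' [dp' [dq' [p0' q0' -> [hp' hq'] dE']]]]].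
rewrite addf_div ?tofrac_eq0 // -!tofracM -tofracD => s0.
exists (p * q' + p' * q), (q * q'), (dp + dq'), (dq + dq'); split=> //.
- by move: s0; rewrite mulf_eq0 negb_or tofrac_eq0 => /andP[].
- by rewrite mulf_neq0.
- split; last exact: homog_polyM.
  (* Both fractions have degree [d], so the two cross products in the numerator have equal
     degree. *)
  have e : dp' + dq = dp + dq'.
    by apply/eqP; rewrite -subr_eq addrAC -dE' dE subrK.
  move=> m /msuppD_le; rewrite mem_cat => /orP[]; first exact: homog_polyM.
  by rewrite -e; apply: homog_polyM.
- by rewrite dE opprD addrACA subrr addr0.
Qed.

Lemma homog_poly1 : homog_poly b delta 1 0.
Proof.
move=> m; rewrite msupp1 inE => /eqP ->.
by rewrite /mono_degree big1 // => k _; rewrite mnm0E mulr0n.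
Qed.

Lemma homogeneous1 : hmg 1 0.
Proof.
have h1 := homog_poly1.
by exists 1, 1, 0, 0; split; rewrite ?oner_neq0 ?tofrac1 ?divr1 ?subr0.
Qed.

Lemma homogeneous_pospart z d (a : int) :
  hmg z d -> hmg (z ^ pospart a) (d *~ pospart a).
Proof.
move=> zd; case: (pospart a) (pospart_ge0 a) => // n _; rewrite -exprnP -pmulrn.
elim: n => [|n IHn]; first exact: homogeneous1.
by rewrite exprS mulrS; apply: homogeneousM.
Qed.

Lemma homogeneous_prod (J : finType) (z : J -> xyfield I) d :
  (forall j, hmg (z j) (d j)) -> hmg (\prod_j z j) (\sum_j d j).
Proof.
move=> zd; elim/big_ind2: _ => //; first exact: homogeneous1.
by move=> *; apply: homogeneousM.
Qed.

Lemma homogeneous_var k : hmg (tofrac 'X_k) (var_degree b delta k).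
Proof.
have h1 := homog_poly1.
exists 'X_k, 1, (var_degree b delta k), 0; split; rewrite ?oner_neq0 ?subr0 //.
- by rewrite -msupp_eq0 msuppX.
- by rewrite tofrac1 divr1.
split=> // m; rewrite msuppX inE => /eqP ->.
rewrite /mono_degree (bigD1 k) //= big1 => [|j jk].
  by rewrite mnm1E eqxx mulr1n addr0.
by rewrite mnm1E eq_sym (negbTE jk) mulr0n.
Qed.

Lemma homogeneous_xvar i : hmg (xvar i) (rho delta i).
Proof.
have := homogeneous_var (lshift #|I| (enum_rank i)).
by rewrite /var_degree -[lshift _ _]/(unsplit (inl _)) unsplitK enum_rankK.
Qed.

Lemma homogeneous_yvar i : hmg (yvar i) (- \sum_j rho delta j *~ b j i).
Proof.
have := homogeneous_var (rshift #|I| (enum_rank i)).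
by rewrite /var_degree -[rshift _ _]/(unsplit (inr _)) unsplitK enum_rankK.
Qed.

End ClusterVariables.

(** * The seed invariant and its preservation by mutation *)

Section SeedInvariant.
Variables (R : realFieldType) (I : finType) (b : I -> I -> int) (delta : I -> R).
Hypothesis hb : skew_symmetrizable b delta.
Local Notation V := (rootspace R I).
Local Notation om := (omega b delta).

(** The families live on an arbitrary [J], so that a mutation can be treated before its columns are
    moved to the adjacent vertex. The field [inv_lattice] says dually that co-labels and simple
    co-roots span the same lattice. *)
Record seed_inv (J : finType) (lb clb : J -> V) (S : seed I J) : Prop := SeedInv {
  inv_bottom : forall i e, (exmat S (inr i) e)%:~R = coef (lb e) i;
  inv_top : forall e f, (exmat S (inl e) f)%:~R = om (clb e) (lb f);
  inv_gvectors : exists2 Y, dual_families clb Y &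
    forall e, homogeneous b delta (cvar S e) (Y e);
  inv_lattice : forall w : weightspace R I,
    (forall i, isint (w (simple_coroot delta i))) <-> (forall e, isint (w (clb e)));
  inv_eval : forall e, evaluates_to (cvar S e) 1
}.

Lemma seed_inv_reindex (J J' : finType) (lb clb : J -> V) (lb' clb' : J' -> V)
    (g : J' -> J) (S : seed I J) :
  bijective g -> (forall e, lb' e = lb (g e)) -> (forall e, clb' e = clb (g e)) ->
  seed_inv lb clb S -> seed_inv lb' clb' (reindex_seed g S).
Proof.
move=> bij_g lbE clbE [bot top [Y YX hY] lat ev].
split=> [i e|e f||w|e] /=; rewrite ?lbE ?clbE //.
- by exists (Y \o g) => [e f|e] //=; rewrite clbE YX (bij_eq bij_g).
rewrite lat; have [h gh hg] := bij_g.
by split=> wi e; [rewrite clbE|rewrite -(hg e) -clbE].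
Qed.

Lemma seed_inv_initial :
  seed_inv (@simple_root R I) (simple_coroot delta) (initial_seed b).
Proof.
have d0 i : delta i != 0 by rewrite gt_eqF // hb.1.
split=> [i e|e f||w|e] //=.
- by rewrite coef_simple_root; case: eqP.
- by rewrite omega_simple.
- exists (rho delta); first exact: coroot_dual hb.
  exact: homogeneous_xvar.
- exact: evaluates_to_xvar.
Qed.

Lemma omega_simple_root x i :
  om x (simple_root R i) = \sum_j coef x j * (delta j * (b j i)%:~R).
Proof.
rewrite /omega; apply: eq_bigr => j _; rewrite (bigD1 i) //= big1 => [|l li].
  by rewrite coef_simple_root eqxx mulr1 addr0.
by rewrite coef_simple_root (negbTE li) mulr0 mul0r.
Qed.

Lemma omega_expand x y : om x y = \sum_i coef y i * om x (simple_root R i).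
Proof.
rewrite /omega exchange_big; apply: eq_bigr => i _ /=.
rewrite -/(om x _) omega_simple_root mulr_sumr; apply: eq_bigr => j _; ring.
Qed.

Definition ydegree i : weightspace R I := - \sum_j rho delta j *~ b j i.

(** Expand [x] in simple co-roots, with coefficients [coef x j * delta j], and pair with the
    fundamental weights. *)
Lemma ydegreeE i x : ydegree i x = - om x (simple_root R i).
Proof.
have d0 j : delta j != 0 by rewrite gt_eqF // hb.1.
have xE : x = \sum_j (coef x j * delta j) *: simple_coroot delta j.
  by rewrite {1}(root_expansion x); apply: eq_bigr => j _; rewrite scalerA mulfK.
rewrite omega_simple_root {1}xE linear_sum -sumrN; apply: eq_bigr => j _.
rewrite linearZ /= /ydegree opp_lfunE (dual_families_sum _ _ (coroot_dual hb)).
by rewrite -[_ *: _]/(_ * _) mulrN mulrA.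
Qed.

Section Mutation.
Variables (J : finType) (lb clb : J -> V) (S : seed I J) (k : J).

Definition lab_mutation (f : J) : V :=
  if f == k then - lb k else lb f + pospart (rsgn (lb k) * om (clb k) (lb f)) *: lb k.

Definition colab_mutation (f : J) : V :=
  if f == k then - clb k
  else clb f + pospart (- rsgn (clb k) * om (clb f) (lb k)) *: clb k.

Hypothesis cardJ : #|J| = #|I|.
Hypothesis clb_pos : forall e, exists2 c : R, 0 < c & clb e = c *: lb e.
Hypothesis lb_neq0 : lb k != 0.
Hypothesis lb_sign : nonneg (lb k) \/ nonneg (- lb k).
Hypothesis invS : seed_inv lb clb S.

Local Notation s := (rsgn (lb k)).
Local Notation B := (exmat S).

Lemma rsgn_clb : rsgn (clb k) = s.
Proof. by have [c c0 ->] := clb_pos k; rewrite rsgnZ. Qed.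

Lemma omega_clb_lb : om (clb k) (lb k) = 0.
Proof. by have [c _ ->] := clb_pos k; rewrite omegaZl (omegaxx hb) mulr0. Qed.

(** Column [k] of the bottom half lists the coordinates of [lb k], all of sign [s], so [sg_pospartM]
    applies in every row. *)
Lemma bottom_mutation i e :
  (exmat (mutation k S) (inr i) e)%:~R = coef (lab_mutation e) i.
Proof.
have [hs sx] := rsgnP lb_sign; have bot := inv_bottom invS; have top := inv_top invS.
rewrite /= /lab_mutation; case: eqP => [->|_]; first by rewrite mulrNz bot coefN.
rewrite intrD intrM intr_sg intr_pospart intrM !bot top coefD coefZ; congr (_ + _).
exact: sg_pospartM.
Qed.

(** Expand by bilinearity: the term in [om (clb k) (lb k)] vanishes, and the two remaining
    corrections are those of [sg_pospart_exchange]. *)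
Lemma top_mutation e f :
  (exmat (mutation k S) (inl e) f)%:~R = om (colab_mutation e) (lab_mutation f).
Proof.
have [hs _] := rsgnP lb_sign; have top := inv_top invS; have kk := omega_clb_lb.
rewrite /= /lab_mutation /colab_mutation -[inl e == inl k]/(e == k) rsgn_clb.
case: eqP => [->|_] /=.
  rewrite mulrNz top; case: eqP => [->|_].
    by rewrite omegaNl (omegaNr hb) kk !oppr0.
  by rewrite omegaNl (omegaDr hb) (omegaZr hb) kk mulr0 addr0.
case: eqP => [->|_].
  by rewrite mulrNz top (omegaNr hb) omegaDl omegaZl kk mulr0 addr0.
rewrite intrD intrM intr_sg intr_pospart intrM !top.
rewrite omegaDl !(omegaDr hb) !omegaZl !(omegaZr hb) kk (sg_pospart_exchange _ _ hs).
ring.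
Qed.

Lemma isint_shift f : isint (pospart (- s * om (clb f) (lb k))).
Proof.
have [hs _] := rsgnP lb_sign; rewrite -(inv_top invS).
by case: hs => ->; rewrite ?mulN1r ?opprK ?mul1r -?mulrNz -intr_pospart; apply: isint_int.
Qed.

Lemma lattice_mutation (w : weightspace R I) :
  (forall e, isint (w (clb e))) <-> (forall e, isint (w (colab_mutation e))).
Proof.
split=> wi e.
  rewrite /colab_mutation rsgn_clb; case: eqP => _.
    by rewrite linearN; exact: (isintN (wi k)).
  rewrite linearD linearZ; exact: (isintD (wi e) (isintM (isint_shift e) (wi k))).
(* Mutation only negates the co-label at [k], so integrality there comes first; the shifts at the
   other indices can then be subtracted. *)
have wk : isint (w (clb k)).
  by have := wi k; rewrite /colab_mutation eqxx linearN => /isintN; rewrite opprK.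
have := wi e; rewrite /colab_mutation rsgn_clb; case: eqP => [-> //|_].
rewrite linearD linearZ /= => /isintD/(_ (isintN (isintM (isint_shift e) wk))).
by rewrite -addrA subrr addr0.
Qed.

(** Cluster variables contribute factors [1], and a frozen variable contributes [0 ^ 0 = 1] or [0]
    according to its exponent. *)
Lemma eval_exchange (a : J + I -> int) (x : J + I -> xyfield I) :
  (forall j, evaluates_to (x (inl j)) 1) -> (forall i, evaluates_to (x (inr i)) 0) ->
  ((forall i, a (inr i) <= 0) ->
     evaluates_to (\prod_p x p ^ pospart (a p)) 1) /\
  ((exists i, 0 < a (inr i)) -> evaluates_to (\prod_p x p ^ pospart (a p)) 0).
Proof.
move=> x1 x0; pose c (p : J + I) : rat := if p is inl _ then 1 else 0.
have xc p : evaluates_to (x p ^ pospart (a p)) (c p ^ pospart (a p)).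
  by apply: evaluates_to_pospart; case: p.
have := evaluates_to_prod xc.
have -> : \prod_p c p ^ pospart (a p) = \prod_i 0 ^ pospart (a (inr i)).
  by rewrite big_sumType /= big1 ?mul1r // => j _; rewrite exp1rz.
move=> ev; split=> [a0|[i ai]]; move: ev.
  by rewrite [X in evaluates_to _ X]big1 // => i _; rewrite pospart_eq0.
by rewrite [X in evaluates_to _ X](bigD1 i) //= pospart_id ?ltW // exp0rz gt_eqF // mul0r.
Qed.

Let Mp := \prod_p row_var S p ^ pospart (B p k).
Let Mn := \prod_p row_var S p ^ pospart (- B p k).

Lemma eval_binomial : evaluates_to (Mp + Mn) 1.
Proof.
have x1 j : evaluates_to (row_var S (inl j)) 1 := inv_eval invS j.
have x0 i : evaluates_to (row_var S (inr i)) 0 := evaluates_to_yvar i.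
have [P1 P0] := eval_exchange (fun p => B p k) x1 x0.
have [N1 N0] := eval_exchange (fun p => - B p k) x1 x0.
have bot := inv_bottom invS.
have [i i0] : exists i, B (inr i) k != 0.
  apply/existsP; apply: contraNT lb_neq0 => /existsPn B0.
  apply/eqP/ffunP => i; rewrite ffunE; have /negPn/eqP Bi := B0 i.
  by rewrite -/(coef (lb k) i) -bot Bi.
case: lb_sign => sg.
  have B0 j : 0 <= B (inr j) k by rewrite -(ler0z R) bot; apply: sg.
  rewrite -[1]add0r; apply: evaluates_toD.
    by apply: P0; exists i; rewrite lt_neqAle eq_sym i0 B0.
  by apply: N1 => j; rewrite oppr_le0.
have B0 j : B (inr j) k <= 0.
  by rewrite -(lerz0 R) bot -oppr_ge0 -coefN; apply: sg.
rewrite -[1]addr0; apply: evaluates_toD; first exact: P1.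
by apply: N0; exists i; rewrite oppr_gt0 lt_neqAle i0 B0.
Qed.

Lemma eval_mutation e : evaluates_to (cvar (mutation k S) e) 1.
Proof.
rewrite /=; case: eqP => _; last exact: inv_eval invS e.
rewrite -[X in evaluates_to _ X]mulr1; apply: evaluates_toM; last exact: eval_binomial.
by rewrite -[X in evaluates_to _ X]invr1; apply: evaluates_toV (inv_eval invS k) _.
Qed.

Section Degrees.
Variable Y : J -> weightspace R I.
Hypothesis Ydual : dual_families clb Y.
Hypothesis Yhom : forall e, homogeneous b delta (cvar S e) (Y e).

Let rowdeg (p : J + I) := match p with inl j => Y j | inr i => ydegree i end.
Let degp := \sum_p rowdeg p *~ pospart (B p k).
Let degn := \sum_p rowdeg p *~ pospart (- B p k).

Lemma homogeneous_row p : homogeneous b delta (row_var S p) (rowdeg p).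
Proof. by case: p => [j|i] /=; [apply: Yhom|apply: homogeneous_yvar]. Qed.

(* The pairing of the bottom half of column k with the degrees of the y's is
   [- omega _ (lb k)], which cancels the contribution of the top half. *)
Lemma degpn : degp = degn.
Proof.
apply/eqP; rewrite -subr_eq0; apply/eqP; rewrite /degp /degn -sumrB.
have -> : \sum_p (rowdeg p *~ pospart (B p k) - rowdeg p *~ pospart (- B p k))
          = \sum_p rowdeg p *~ B p k.
  by apply: eq_bigr => p _; rewrite -mulrzBr pospartB.
apply: (weight_eq cardJ Ydual) => f.
rewrite big_sumType /= add_lfunE (dual_families_sum _ _ Ydual).
rewrite (inv_top invS) omega_expand sum_lfunE -big_split /= big1 ?zero_lfunE // => i _.
rewrite -scaler_int scale_lfunE ydegreeE (inv_bottom invS) -[_ *: _]/(_ * _).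
by rewrite mulrN subrr.
Qed.

(** Since the two monomials have equal degree, the one without frozen variables can be used; pairing
    its degree with [clb f] reads off the exponent at [f]. *)
Lemma degp_apply f : degp (clb f) = pospart (- s * om (clb f) (lb k)).
Proof.
have [hs sx] := rsgnP lb_sign.
have bot := inv_bottom invS; have top := inv_top invS.
have bsplit (a : J + I -> int) : (forall i, a (inr i) <= 0) ->
    (\sum_p rowdeg p *~ pospart (a p)) (clb f) = pospart (a (inl f))%:~R.
  move=> a0; rewrite big_sumType /= [X in _ + X]big1 => [|i _].
    by rewrite addr0 (dual_families_sum _ _ Ydual) intr_pospart.
  by rewrite pospart_eq0 // mulr0z.
case: hs sx => -> sx.
  rewrite degpn bsplit ?mulrNz ?top ?mulN1r // => i.
  by rewrite oppr_le0 -(ler0z R) bot -[coef _ _]mul1r.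
rewrite opprK mul1r bsplit ?top // => i.
by rewrite -(lerz0 R) bot -oppr_ge0 -mulN1r.
Qed.

Definition gvector_mutation e := if e == k then - Y k + degp else Y e.

Lemma homogeneous_mutation e :
  homogeneous b delta (cvar (mutation k S) e) (gvector_mutation e).
Proof.
rewrite /gvector_mutation /=; case: eqP => _; last exact: Yhom.
apply: homogeneousM; first exact/homogeneousV/Yhom.
have hM (a : J + I -> int) : homogeneous b delta
    (\prod_p row_var S p ^ pospart (a p)) (\sum_p rowdeg p *~ pospart (a p)).
  by apply: homogeneous_prod => p; apply/homogeneous_pospart/homogeneous_row.
apply: homogeneousD; first exact: hM.
  by rewrite degpn; apply: hM.
(* The binomial is nonzero because it evaluates to [1]. *)
by have := evaluates_to_neq0 eval_binomial; apply; rewrite oner_neq0.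
Qed.

(** At [k] against [f != k], the value of [- Y k] on the shift of [clb f] cancels [degp (clb f)],
    while [degp] vanishes on [clb k]. *)
Lemma gvector_mutation_dual : dual_families colab_mutation gvector_mutation.
Proof.
have kk : degp (clb k) = 0 by rewrite degp_apply omega_clb_lb mulr0 pospart_eq0.
move=> e f; rewrite /colab_mutation /gvector_mutation rsgn_clb.
have [->|ek] := eqVneq e k; have [fk|fk] := eqVneq f k.
- by rewrite linearN /= add_lfunE opp_lfunE Ydual kk ?eqxx addr0 opprK.
- rewrite linearD linearZ /= !add_lfunE !opp_lfunE !Ydual kk eqxx ?(eq_sym k) (negbTE fk).
  by rewrite degp_apply oppr0 add0r addr0 -[_ *: _]/(_ * _) mulrN1 subrr.
- by rewrite fk linearN /= Ydual (negbTE ek) oppr0.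
by rewrite linearD linearZ /= !Ydual (negbTE ek) scaler0 addr0.
Qed.

End Degrees.

Lemma seed_inv_mutation : seed_inv lab_mutation colab_mutation (mutation k S).
Proof.
have [Y YX hY] := inv_gvectors invS.
split; [exact: bottom_mutation|exact: top_mutation| | |exact: eval_mutation].
  exists (gvector_mutation Y); first exact: gvector_mutation_dual.
  by move=> e; apply: homogeneous_mutation.
by move=> w; rewrite (inv_lattice invS) lattice_mutation.
Qed.

(** The constant relating [clb f] to [lb f] survives mutation, by skew-symmetry of [omega]. *)
Lemma colab_mutationE f :
  exists2 c : R, 0 < c & colab_mutation f = c *: lab_mutation f.
Proof.
have [c c0 cE] := clb_pos f; exists c => //; have [d d0 dE] := clb_pos k.
rewrite /colab_mutation /lab_mutation rsgn_clb; case: eqP => [fk|_].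
  by rewrite -fk cE scalerN.
rewrite cE dE scalerDr !scalerA; congr (_ + _ *: _).
rewrite !omegaZl (omegaC hb (lb f)) -[in RHS]pospartMl ?ltW //.
rewrite [LHS]mulrC -pospartMl ?ltW //; congr pospart; ring.
Qed.

End Mutation.

(** Serves to identify edges: labels are multiples of co-labels, so proportional labels at a vertex
    belong to one edge. *)
Lemma dual_families_sep (J : finType) (X : J -> V) Y e f (c : R) :
  dual_families X Y -> X e = c *: X f -> e = f.
Proof.
move=> XY Xef; apply/eqP; have := XY e e; rewrite Xef linearZ /= XY eqxx.
by case: (e == f) => // /eqP; rewrite scaler0 eq_sym oner_eq0.
Qed.

End SeedInvariant.

(** * Transport of the invariant along walks in the framework *)

Section WalkInvariant.
Variables (R : realFieldType) (I : finType) (b : I -> I -> int) (delta : I -> R).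
Hypothesis hb : skew_symmetrizable b delta.
Variables (G : quasigraph) (F : framework b delta G).

Lemma card_star (v : vertex G) : #|{: star v}| = #|I|.
Proof. by rewrite -(fw_regular F v) cardfE. Qed.

Lemma lab_base_index (e : star (base F)) : lab F e = simple_root R (base_index e).
Proof. exact/eqP/(xchooseP (base_lab e)). Qed.

Lemma simple_root_sep (i j : I) (c : R) :
  simple_root R i = c *: simple_root R j -> i = j.
Proof.
move=> /(congr1 (fun x => coef x i)); rewrite coefZ !coef_simple_root eqxx.
by have [//|_ /eqP] := eqVneq; rewrite mulr0 oner_eq0.
Qed.

Lemma colab_base_index (e : star (base F)) :
  colab F e = simple_coroot delta (base_index e).
Proof.
(* The axioms index labels and co-labels at the base independently; proportionality forces the two
   indices to agree. *)
have [i ei] := base_colab e; have [c c0 eE] := colab_pos F e.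
suff <- : i = base_index e by [].
have d0 : delta i != 0 by rewrite gt_eqF // hb.1.
apply: (@simple_root_sep _ _ (delta i * c)).
by rewrite -scalerA -lab_base_index -eE ei scalerA mulfV // scale1r.
Qed.

Lemma base_index_bij : bijective (@base_index _ _ _ _ _ F).
Proof.
have surj (i : I) : exists e : star (base F), base_index e == i.
  have [e eE] := base_lab_onto F i; exists e.
  by apply/eqP/(@simple_root_sep _ _ 1); rewrite scale1r -lab_base_index.
pose h i := xchoose (surj i).
have hK : cancel h (@base_index _ _ _ _ _ F) by move=> i; apply/eqP/(xchooseP (surj i)).
by apply: (bij_can_bij (inj_card_bij (can_inj hK) _) hK); rewrite card_star.
Qed.

Section Step.
Variables (u v : vertex G) (e : edge G) (uv : u != v).
Variables (eu : e \in star u) (ev : e \in star v) (S : seed I (star u)).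
Hypothesis invS : seed_inv b delta (@lab _ _ _ _ _ F u) (@colab _ _ _ _ _ F u) S.

Let lb' := lab_mutation b delta (@lab _ _ _ _ _ F u) (@colab _ _ _ _ _ F u) [` eu]%fset.
Let clb' := colab_mutation b delta (@lab _ _ _ _ _ F u) (@colab _ _ _ _ _ F u) [` eu]%fset.
Let mu := mu_edge F [` eu]%fset [` ev]%fset.

Lemma step_inv : seed_inv b delta lb' clb' (mutation [` eu]%fset S).
Proof.
apply: seed_inv_mutation => //; [exact: card_star|exact: colab_pos|exact: lab_neq0|].
exact: lab_sign.
Qed.

(** The mutated labels are positive multiples of the mutated co-labels, which have a dual family. *)
Lemma lab_mutation_sep f g (c : R) : lb' f = c *: lb' g -> f = g.
Proof.
have [Y YX _] := inv_gvectors step_inv.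
have pos := colab_mutationE hb [` eu]%fset (@colab_pos _ _ _ _ _ F u).
have [cf cf0 fE] := pos f; have [cg cg0 gE] := pos g.
move=> fg; apply: (dual_families_sep (c := cf * c / cg) YX).
by rewrite /clb' fE gE -/lb' fg !scalerA mulfVK // gt_eqF.
Qed.

(** Turns [f != e] into the inequality of labels required by [lab_trans] and [colab_trans]. *)
Lemma lab_injective : injective (@lab _ _ _ _ _ F u).
Proof.
have [Y YX _] := inv_gvectors invS.
move=> f g fg; have [cf cf0 fE] := colab_pos F f; have [cg cg0 gE] := colab_pos F g.
apply: (dual_families_sep (c := cf / cg) YX).
by rewrite fE gE fg scalerA mulfVK // gt_eqF.
Qed.

Lemma lab_mu f : lab F (mu f) = lb' f.
Proof.
rewrite /mu /mu_edge /lb' /lab_mutation; have [_|fe] := eqVneq.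
  by have [-> _] := lab_opp F (e := [` eu]%fset) (e' := [` ev]%fset) uv erefl.
(* Away from the crossed edge, [lab_trans] rules out the default value of [mu_edge]. *)
case: pickP => [f' /eqP //|no].
have fe' : lab F f != lab F [` eu]%fset by rewrite (inj_eq lab_injective).
have [f' /eqP f'E] := lab_trans (e := [` eu]%fset) (e' := [` ev]%fset) uv erefl fe'.
by have := no f'; rewrite f'E.
Qed.

Lemma mu_bij : bijective mu.
Proof.
apply: inj_card_bij; last by rewrite !card_star.
move=> f g fg; apply: (@lab_mutation_sep _ _ 1).
by rewrite scale1r -!lab_mu fg.
Qed.

(* The label of the edge supplied by [colab_trans] is proportional to that of
   [mu f], and no two labels at a vertex are proportional. *)
Lemma colab_mu f : colab F (mu f) = clb' f.
Proof.
have [h muK hK] := mu_bij.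
have pos := colab_mutationE hb [` eu]%fset (@colab_pos _ _ _ _ _ F u).
suff [f' f'E] : exists f' : star v, colab F f' = clb' f.
  have [c c0 fE] := pos f; have [d d0 dE] := colab_pos F f'.
  suff hf : h f' = f by rewrite -[in LHS]hf hK.
  apply: (@lab_mutation_sep _ _ (d^-1 * c)).
  rewrite -scalerA -fE -/clb' -f'E -lab_mu hK dE scalerA mulVf ?scale1r //.
  by rewrite gt_eqF.
rewrite /clb' /colab_mutation; have [_|fe] := eqVneq.
  exists [` ev]%fset.
  by have [_ ->] := lab_opp F (e := [` eu]%fset) (e' := [` ev]%fset) uv erefl.
apply: (colab_trans (e := [` eu]%fset) (e' := [` ev]%fset) uv erefl).
by rewrite (inj_eq lab_injective).
Qed.

Lemma mu_edge_invK : cancel (mu_edge_inv F [` eu]%fset [` ev]%fset) mu.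
Proof.
move=> f'; rewrite /mu_edge_inv; case: pickP => [f /eqP //|no].
(* Surjectivity of [mu] excludes the default value. *)
by have [h _ hK] := mu_bij; have := no (h f'); rewrite -/mu hK eqxx.
Qed.

Lemma seed_inv_step :
  seed_inv b delta (@lab _ _ _ _ _ F v) (@colab _ _ _ _ _ F v)
    (reindex_seed (mu_edge_inv F [` eu]%fset [` ev]%fset) (mutation [` eu]%fset S)).
Proof.
apply: seed_inv_reindex step_inv => [|f|f].
- have [h muK hK] := mu_bij; exists mu => [|f]; first exact: mu_edge_invK.
  by apply: (can_inj muK); apply: mu_edge_invK.
- by rewrite -lab_mu mu_edge_invK.
- by rewrite -colab_mu mu_edge_invK.
Qed.

End Step.

Lemma walk_seed_inv (u : vertex G) (w : walk F u) :
  seed_inv b delta (@lab _ _ _ _ _ F u) (@colab _ _ _ _ _ F u) (walk_seed w).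
Proof.
elim: w => [|u' w' IH v e uv eu ev] /=; last exact: seed_inv_step.
apply: seed_inv_reindex (seed_inv_initial hb); first exact: base_index_bij.
- exact: lab_base_index.
- exact: colab_base_index.
Qed.

End WalkInvariant.

Theorem theorem3p24 (R : realFieldType) (I : finType) (b : I -> I -> int)
    (delta : I -> R) (hb : skew_symmetrizable b delta)
    (G : quasigraph) (F : framework b delta G) (v : cover_vertex F) :
  let S := cover_seed v in
  let H := fun (i : I) (e : cover_star v) => exmat S (inr i) e in
  let g := fun e : cover_star v => gvector b delta (cvar S e) in
  [/\ forall i e, (H i e)%:~R = coef (cover_lab e) i,
      forall e, (forall i, 0 <= H i e) \/ (forall i, H i e <= 0),
      forall e, homogeneous b delta (cvar S e) (g e) /\ g e = cover_R e,
      Zbasis_of_weight_lattice delta g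
    & forall e, exists2 f, Fpolynomial (cvar S e) f & constant_term f 1].
Proof.
move=> S H g; have [bot _ [Y YX hY] lat ev] := walk_seed_inv hb (cover_walk v).
have gY e : g e = Y e by apply/gvectorE/hY.
have cv : #|{: cover_star v}| = #|I| := card_star F _.
split=> [||e||e]; first exact: bot.
- move=> e; case: (lab_sign F e) => sg; [left|right] => i.
    by rewrite -(ler0z R) bot; apply: sg.
  by rewrite -(lerz0 R) bot -oppr_ge0 -coefN; apply: sg.
- rewrite gY; split; first exact: hY.
  (* Both families are dual to the co-labels, and a weight is determined by its values there. *)
  apply: (weight_eq cv YX) => f; rewrite YX.
  rewrite /cover_R -[colab F f]/(cover_colab f) dual_basisE //.
  exact: dual_families_free YX.
- split=> [e|w /(weight_latticeP hb) /lat wi].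
    (* On co-labels [Y] takes the values [0] and [1]; [lat] transfers integrality to the simple
       co-roots. *)
    rewrite gY; apply/(weight_latticeP hb)/lat => f.
    by rewrite YX; case: eqP => _; [exact: (isint_int R 1)|exact: (isint_int R 0)].
  (* The coefficients are the values of [w] on the co-labels, integers by [lat]; evaluating there
     also gives uniqueness. *)
  have /fin_all_exists[c wc] := wi.
  have app (d : {ffun cover_star v -> int}) f :
      (\sum_e g e *~ d e) (colab F f) = (d f)%:~R.
    by under eq_bigr do rewrite gY; apply: dual_families_sum YX.
  exists [ffun e => c e]; split.
    by apply: (weight_eq cv YX) => f; rewrite app ffunE.
  move=> d wd; apply/ffunP => f; rewrite ffunE; apply: (@intr_inj R).
  by rewrite -wc wd app.
- exact/evaluates_to_Fpolynomial/ev.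
Qed.
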